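(* Let $W$ be a finite Weyl group with longest element $w_0$, let $W'$ be a parabolic subgroup of $W$, and let $w'_0$ be the longest element of $W'$. Then $\mathbf{H}\underline{\hat{H}}_{w_0w'_0}=\mathbf{LN}_{w_0w'_0}$, where $\mathbf{H}\underline{\hat{H}}_{w_0w'_0}$ is the left ideal of the Hecke algebra $\mathbf{H}$ of $W$ generated by the dual Kazhdan-Lusztig basis element $\underline{\hat{H}}_{w_0w'_0}$, and $\mathbf{LN}_{w_0w'_0}$ is the $\mathbb{Z}[v,v^{-1}]$-span of all $\underline{\hat{H}}_u$ with $u\leq_L w_0w'_0$.
   Context: Let $W$ be a finite Weyl group with set $S$ of simple reflections and identity $e$. A parabolic subgroup of $W$ is a subgroup generated by a subset of $S$. Put $\mathbb{A}=\mathbb{Z}[v,v^{-1}]$. The Hecke algebra $\mathbf{H}$ of $W$ is the $\mathbb{A}$-algebra generated by $H_s$, $s\in S$, subject to the braid relations of $(W,S)$ and $H_s^2=H_e+(v^{-1}-v)H_s$; it has the standard $\mathbb{A}$-basis $\{H_w : w\in W\}$, where $H_w=H_{s_1}\cdots H_{s_k}$ for any reduced expression $w=s_1\cdots s_k$. The bar involution is the ring automorphism of $\mathbf{H}$ with $\overline{v}=v^{-1}$ and $\overline{H_s}=H_s^{-1}$. The Kazhdan-Lusztig (KL) basis $\{\underline{H}_w : w\in W\}$ is uniquely determined by $\overline{\underline{H}_w}=\underline{H}_w$ and $\underline{H}_w\in H_w+\sum_{x\in W}v\mathbb{Z}[v]H_x$. Let $\boldsymbol{\tau}:\mathbf{H}\to\mathbb{A}$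 be the $\mathbb{A}$-linear map with $\boldsymbol{\tau}(H_e)=1$ and $\boldsymbol{\tau}(H_w)=0$ for $w\neq e$. The dual KL basis $\{\underline{\hat{H}}_w : w\in W\}$ is defined by $\boldsymbol{\tau}(\underline{\hat{H}}_x\underline{H}_{y^{-1}})=\delta_{x,y}$ for all $x,y\in W$. The left KL pre-order: $x\leq_L y$ if there is $w\in W$ such that $\underline{H}_y$ appears with a non-zero coefficient in the expansion of $\underline{H}_w\underline{H}_x$ in the KL basis. *)

(* Defs.v *)
From HB Require Import structures.
From mathcomp Require Import all_boot all_order all_algebra all_fingroup.
From mathcomp Require Import boolp classical_sets reals.

Set Implicit Arguments.
Unset Strict Implicit.
Unset Printing Implicit Defensive.

Import GRing.Theory.
Local Open Scope ring_scope.

Local Notation "p %:F" := (tofrac p).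

(* Z[v, v^-1], as the subring of Frac(Z['X]) of all fractions p / 'X^n.       *)
Definition laurent_pred : {pred {fraction {poly int}}} :=
  fun x => `[< exists (p : {poly int}) (n : nat), x = p%:F / 'X%:F ^+ n >].

Lemma fracX_neq0 : 'X%:F != 0 :> {fraction {poly int}}.
Proof. by rewrite tofrac_eq0 polyX_eq0. Qed.

Fact laurent_subring_closed : subring_closed laurent_pred.
Proof.
split.
- by apply/asboolP; exists 1, 0%N; rewrite expr0 divr1 rmorph1.
- move=> x y /asboolP[p [m ->]] /asboolP[q [n ->]]; apply/asboolP.
  exists (p * 'X^n - q * 'X^m), (m + n)%N.
  rewrite rmorphB !rmorphM !rmorphXn /= exprD.
  have Xn0 k : 'X%:F ^+ k != 0 :> {fraction {poly int}}.
    by rewrite expf_neq0 ?fracX_neq0.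
  rewrite mulrBl -[in RHS]mulf_div divff // mulr1; congr (_ - _).
  by rewrite [_ * 'X%:F ^+ m]mulrC -mulf_div divff // mul1r.
- move=> x y /asboolP[p [m ->]] /asboolP[q [n ->]]; apply/asboolP.
  by exists (p * q), (m + n)%N; rewrite rmorphM exprD invfM mulrACA.
Qed.

HB.instance Definition _ :=
  GRing.isSubringClosed.Build {fraction {poly int}} laurent_pred
    laurent_subring_closed.

Record laurent := Laurent {
  laurent_val :> {fraction {poly int}};
  laurent_valP : laurent_val \in laurent_pred
}.

HB.instance Definition _ := [isSub for laurent_val].
HB.instance Definition _ := [Choice of laurent by <:].
HB.instance Definition _ := [SubChoice_isSubComNzRing of laurent by <:].

Fact laurent_X_subproof : 'X%:F \in laurent_pred.
Proof. by apply/asboolP; exists 'X, 0%N; rewrite expr0 divr1. Qed.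

Fact laurent_XV_subproof : 'X%:F^-1 \in laurent_pred.
Proof. by apply/asboolP; exists 1, 1%N; rewrite rmorph1 div1r expr1. Qed.

Definition v : laurent := Laurent laurent_X_subproof.
Definition vV : laurent := Laurent laurent_XV_subproof.

Lemma mulvV : v * vV = 1.
Proof. by apply: val_inj; rewrite /= divff ?fracX_neq0. Qed.

Definition in_vZv (a : laurent) : Prop :=
  exists p : {poly int}, a = v * (map_poly intr p).[v].

Section RootSystem.
Variables (R : realType) (n : nat).
Implicit Types (a b : 'rV[R]_n) (Phi Delta : seq 'rV[R]_n).

Definition dot a b : R := (a *m b^T) 0 0.

(* Matrices act on row vectors from the right:                                *)
(* x *m reflmx a = x - (2 * dot x a / dot a a) *: a.                          *)
Definition reflmx a : 'M[R]_n := 1%:M - (2 / dot a a) *: (a^T *m a).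

Record is_root_system Phi : Prop := {
  root_span : <<Phi>>%VS = fullv;
  root_neq0 : 0 \notin Phi;
  root_refl : forall a b, a \in Phi -> b \in Phi -> b *m reflmx a \in Phi;
  root_reduced : forall a (c : R),
    a \in Phi -> c *: a \in Phi -> c = 1 \/ c = -1;
  root_integral : forall a b, a \in Phi -> b \in Phi ->
    exists z : int, 2 * dot b a / dot a a = z%:~R
}.

Record is_simple_system Phi Delta : Prop := {
  simple_root : {subset Delta <= Phi};
  simple_basis : basis_of fullv Delta;
  simple_sign : forall a, a \in Phi -> exists c : 'rV[R]_n -> nat,
    a = \sum_(d <- Delta) (c d)%:R *: d \/
    a = - \sum_(d <- Delta) (c d)%:R *: d
}.

End RootSystem.

(* The whole of gT is, through a faithful representation rho, the Weyl group  *)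
(* of a crystallographic root system in the Euclidean space R^n, and S is the *)
(* set of reflections along the roots of some base.                           *)
Definition is_weyl_group (R : realType) (gT : finGroupType) (S : {set gT}) :
    Prop :=
  exists (n : nat) (Phi Delta : seq 'rV[R]_n) (rho : gT -> 'M[R]_n),
    [/\ is_root_system Phi /\ is_simple_system Phi Delta,
        {morph rho : x y / (x * y)%g >-> x *m y} /\ injective rho,
        forall a, a \in Phi -> exists w, rho w = reflmx a,
        <<[set w | has (fun a => rho w == reflmx a) Phi]>>%g = [set: gT] &
        S = [set w | has (fun a => rho w == reflmx a) Delta]].

Section Length.
Variables (gT : finGroupType) (S : {set gT}).

Definition has_expr (w : gT) (k : nat) : bool :=
  [exists t : k.-tuple gT,
     all [in S] t && (\prod_(s <- t) s == w)%g].

(* The least k such that w is a product of k elements of S; for w in <<S>>    *)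
(* such a k exists below #|gT|.                                               *)
Definition len (w : gT) : nat := find (has_expr w) (iota 0 #|gT|).

Definition reduced (t : seq gT) : Prop :=
  all [in S] t /\ len (\prod_(s <- t) s)%g = size t.

Definition is_parabolic (W' : {group gT}) : Prop :=
  exists2 J : {set gT}, J \subset S & W' = <<J>>%G.

(* Also for G parabolic, lengths are taken in the ambient group, w.r.t. S;     *)
(* on a parabolic subgroup they agree with its own length function.           *)
Definition is_longest (G : {set gT}) (w : gT) : Prop :=
  w \in G /\ forall x, x \in G -> (len x <= len w)%N.

End Length.

Fixpoint altprod (B : pzRingType) (m : nat) (a b : B) : B :=
  if m is m'.+1 then a * altprod m' b a else 1.

Section Hecke.
Variables (gT : finGroupType) (S : {set gT}).

(* #[s * t] is the Coxeter exponent m(s, t).                                  *)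
Definition hecke_relations (B : algType laurent) (h : gT -> B) : Prop :=
  (forall s, s \in S -> h s * h s = 1 + (vV - v) *: h s) /\
  (forall s t, s \in S -> t \in S ->
     altprod #[s * t]%g (h s) (h t) = altprod #[s * t]%g (h t) (h s)).

Variables (H : algType laurent) (T : gT -> H).

(* H is presented by the generators T s, s \in S, and the above relations.    *)
(* Only the values of T on S matter here; T is extended to the whole group by *)
(* is_standard_basis.                                                         *)
Record is_hecke_algebra : Prop := {
  hecke_rel : hecke_relations T;
  hecke_gen : forall P : H -> Prop,
    P 1 ->
    (forall c x y, P x -> P y -> P (c *: x + y)) ->
    (forall x y, P x -> P y -> P (x * y)) ->
    (forall s, s \in S -> P (T s)) ->
    forall h, P h;
  hecke_univ : forall (B : algType laurent) (h : gT -> B),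
    hecke_relations h ->
    exists phi : {lrmorphism H -> B}, forall s, s \in S -> phi (T s) = h s
}.

Definition is_standard_basis : Prop :=
  forall t : seq gT, reduced S t ->
    T (\prod_(s <- t) s)%g = \prod_(s <- t) T s.

Definition is_bar_involution (bar : {rmorphism H -> H}) : Prop :=
  [/\ bijective bar, bar (v%:A) = vV%:A &
      forall s, s \in S -> bar (T s) * T s = 1 /\ T s * bar (T s) = 1].

Definition is_KL_basis (bar : H -> H) (C : gT -> H) : Prop :=
  forall w, bar (C w) = C w /\
    exists c : gT -> laurent,
      (forall x, in_vZv (c x)) /\ C w = T w + \sum_x c x *: T x.

Definition is_trace (tau : {scalar H}) : Prop :=
  forall w, tau (T w) = (w == 1%g)%:R.

Definition is_dual_KL_basis (tau : {scalar H}) (C D : gT -> H) : Prop :=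
  forall x y, tau (D x * C y^-1%g) = (x == y)%:R.

Definition leqL (C : gT -> H) (x y : gT) : Prop :=
  exists (w : gT) (c : gT -> laurent),
    C w * C x = \sum_z c z *: C z /\ c y != 0.

Definition left_ideal (d : H) : set H := [set h * d | h in [set: H]]%classic.

Definition LN (C D : gT -> H) (y : gT) : set H :=
  [set x | exists c : gT -> laurent,
     (forall u, ~ leqL C u y -> c u = 0) /\ x = \sum_u c u *: D u]%classic.

End Hecke.

(* Main.v *)
(* Write x0 = w0 w0' and W' = <<J>>. The left ideal A of all h with h C_s = 0
   for s in J is generated by eta = sum over w in W' of (-v)^(len w) T_w, and an
   element of A is determined by its coefficients at the minimal representatives
   of the cosets x W'; x0 is the unique longest of these. Since C_s C_z lies in
   the span of the C_x with s x < x, D_x0 belongs to A, and its coefficient at a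
   minimal representative m is 1 if m = x0 and 0 otherwise, because D is
   unitriangular with respect to length. Hence D_x0 = T_x0 eta, and T_x0 being a
   unit, H D_x0 = A. The anti-involution T_w -> T_(w^-1) identifies the
   coefficient of D_u in C_(w^-1) D_x0 with that of C_x0 in C_w C_u, so H D_x0
   is contained in LN; conversely u <=_L x0 forces u s > u for s in J, as
   C_s C_(u^-1) = (v + v^-1) C_(u^-1) otherwise, so D_u lies in A.
   The exchange condition is read off from the associativity of H. *)
Require Import Defs.
From HB Require Import structures.
From mathcomp Require Import all_boot all_order all_algebra all_fingroup.
From mathcomp Require Import boolp classical_sets reals.
From mathcomp Require Import zify ring.

Set Implicit Arguments.
Unset Strict Implicit.
Unset Printing Implicit Defensive.

Import GRing.Theory Num.Theory.
Local Open Scope ring_scope.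

(** * Reflections and the sign character of a Weyl group *)

Lemma det_1Bcolrow (F : comUnitRingType) (n : nat) (a : 'rV[F]_n)
    (b : 'cV[F]_n) : \det (1%:M - b *m a) = 1 - (a *m b) 0 0.
Proof.
have ->: 1 - (a *m b) 0 0 = \det (1%:M - a *m b).
  by rewrite det_mx11 !mxE eqxx.
(* Clearing either off-diagonal block factors [X] into block triangular matrices; the two resulting
   values of [\det X] are the two sides. *)
pose X := block_mx (1%:M : 'M_1) a b (1%:M : 'M_n).
have detX1 : \det X = \det (1%:M - b *m a).
  have ->: X = block_mx 1%:M 0 b 1%:M *m block_mx 1%:M a 0 (1%:M - b *m a).
    rewrite mulmx_block !(mul1mx, mul0mx, mulmx1, mulmx0, addr0).
    by rewrite addrC subrK.
  by rewrite det_mulmx det_lblock det_ublock !det1 !mul1r.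
have detX2 : \det X = \det (1%:M - a *m b).
  have ->: X = block_mx 1%:M a 0 1%:M *m block_mx (1%:M - a *m b) 0 b 1%:M.
    rewrite mulmx_block !(mul1mx, mul0mx, mulmx1, mulmx0, add0r).
    by rewrite subrK.
  by rewrite det_mulmx det_lblock det_ublock !det1 !mul1r mulr1.
by rewrite -detX1.
Qed.

Section Weyl.
Variables (R : realType) (gT : finGroupType) (S : {set gT}).

Lemma dot_gt0 (n : nat) (a : 'rV[R]_n) : a != 0 -> 0 < dot a a.
Proof.
move=> /matrix0Pn[i [j aij]]; rewrite (ord1 i) in aij.
rewrite /dot mxE (bigD1 j) //= ltr_pwDl //.
  by rewrite mxE -expr2 exprn_even_gt0.
by apply: sumr_ge0 => k _; rewrite mxE -expr2 sqr_ge0.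
Qed.

Lemma reflmxK (n : nat) (a : 'rV[R]_n) :
  a != 0 -> reflmx a *m reflmx a = 1%:M.
Proof.
move=> /dot_gt0 /lt0r_neq0 a0.
have aa : (a^T *m a) *m (a^T *m a) = dot a a *: (a^T *m a).
  rewrite mulmxA -(mulmxA a^T a a^T) [a *m a^T]mx11_scalar mul_mx_scalar.
  by rewrite -scalemxAl.
rewrite /reflmx mulmxBl mul1mx mulmxBr mulmx1 -scalemxAl -scalemxAr aa !scalerA.
have ->: 2 / dot a a * (2 / dot a a) * dot a a = 2 / dot a a + 2 / dot a a.
  by field.
by rewrite scalerDl opprB addrK subrK.
Qed.

Lemma det_reflmx (n : nat) (a : 'rV[R]_n) : a != 0 -> \det (reflmx a) = -1.
Proof.
move=> /dot_gt0 /lt0r_neq0 a0.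
rewrite /reflmx scalemxAl det_1Bcolrow -scalemxAr mxE.
by rewrite -/(dot a a) -mulrA mulVf // mulr1; ring.
Qed.

Hypothesis hW : is_weyl_group R S.

Lemma weyl_sqr (s : gT) : s \in S -> (s * s = 1)%g.
Proof.
case: hW => n [Phi [Delta [rho [[rPhi sD] [rM rI] _ _ ->]]]].
rewrite inE => /hasP[a aD /eqP rs].
have a0 : a != 0.
  by apply: contraTneq (simple_root sD aD) => ->; apply: root_neq0 rPhi.
(* [rho] is only assumed multiplicative; its value at the unit is recovered from the invertible
   matrix [rho s]. *)
have r1 : rho 1%g = 1%:M.
  rewrite -[rho _]mulmx1 -(reflmxK a0) mulmxA -rs -rM mul1g rs.
  by rewrite reflmxK.
by apply: rI; rewrite rM rs reflmxK.
Qed.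

(** The determinant of the reflection representation is such a character. It supplies the parity
    argument of [lenMl_neq]. *)
Lemma weyl_sign : exists sgn : gT -> R,
  {morph sgn : x y / (x * y)%g >-> x * y} /\ {in S, forall s, sgn s = -1}.
Proof.
case: hW => n [Phi [Delta [rho [[rPhi sD] [rM rI] _ _ ->]]]].
exists (fun w => \det (rho w)); split => [x y|s]; first by rewrite rM det_mulmx.
rewrite inE => /hasP[a aD /eqP ->]; apply: det_reflmx.
by apply: contraTneq (simple_root sD aD) => ->; apply: root_neq0 rPhi.
Qed.

End Weyl.

(** * Word length with respect to the simple reflections *)

Section LengthTheory.
Variables (gT : finGroupType) (S : {set gT}).

Lemma len_prod_le (t : seq gT) :
  all [in S] t -> (len S (\prod_(s <- t) s)%g <= size t)%N.
Proof.
move=> tS; rewrite /len; set w := (\prod_(s <- t) s)%g.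
(* [find] never exceeds [#|gT|], so the bound is automatic for words at least that long. *)
have [tn|tn] := ltnP (size t) #|gT|; last first.
  by apply: leq_trans tn; rewrite -{2}(size_iota 0 #|gT|) find_size.
rewrite leqNgt; apply/negP => /(before_find 0); rewrite nth_iota // add0n.
move/negbT/negP; apply; rewrite /has_expr; apply/fintype.existsP.
by exists (in_tuple t); rewrite tS eqxx.
Qed.

Lemma len1 : len S 1%g = 0%N.
Proof.
apply/eqP; rewrite -leqn0.
by have := @len_prod_le [::] isT; rewrite big_nil.
Qed.

(** Words are paths in the Cayley graph. A path shortened to have no repeated vertex has fewer than
    [#|gT|] edges, so the bounded search in [len] succeeds. *)
Lemma len_exprP (w : gT) : w \in <<S>>%g -> exists t : seq gT,
  [/\ all [in S] t, (\prod_(s <- t) s)%g = w & size t = len S w].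
Proof.
move=> wS; pose e : rel gT := fun x y => (x^-1 * y)%g \in S.
have eE (x : gT) (p : seq gT) : path e x p -> exists t : seq gT,
    [/\ all [in S] t, (x * \prod_(s <- t) s)%g = last x p & size t = size p].
  elim: p x => [|y p IH] x /=; first by exists [::]; rewrite big_nil mulg1.
  case/andP=> exy /IH[t [tS tl ts]]; exists ((x^-1 * y)%g :: t).
  by rewrite big_cons /= ts tS [_ \in S]exy mulgA mulKVg.
have : connect e 1%g w.
  case/gen_prodgP: wS => k [c cS ->] {w}.
  elim: k c cS => [|k IH] c cS; first by rewrite big_ord0 connect0.
  rewrite big_ord_recr /=.
  apply: connect_trans (IH _ (fun i => cS (widen_ord (leqnSn k) i))) _.
  by apply: connect1; rewrite /e mulKg.
case/connectP=> p0 /shortenP[p /eE[t [tS]]].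
rewrite mul1g => tl ts /= /andP[p1 pu] _ wl; rewrite -wl in tl => {p0}.
have hasw : has (has_expr S w) (iota 0 #|gT|).
  apply/hasP; exists (size t); last first.
    rewrite /has_expr; apply/fintype.existsP; exists (in_tuple t).
    by rewrite tS -tl eqxx.
  rewrite mem_iota /= add0n ts.
  have /card_uniqP : uniq (1%g :: p) by rewrite /= p1.
  by move=> /= <-; apply: max_card.
have := nth_find 0 hasw; rewrite nth_iota; last first.
  by rewrite -{2}(size_iota 0 #|gT|) -has_find.
rewrite add0n => /fintype.existsP[u /andP[uS /eqP uw]].
by exists u; rewrite uS uw size_tuple.
Qed.

Lemma len_eq0 (w : gT) : w \in <<S>>%g -> len S w = 0%N -> w = 1%g.
Proof.
by case/len_exprP=> t [_ <- <-] /size0nil ->; rewrite big_nil.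
Qed.

Hypothesis sqrS : {in S, forall s, s * s = 1}%g.

Lemma invS (s : gT) : s \in S -> s^-1%g = s.
Proof. by move=> sS; apply: (mulgI s); rewrite mulgV sqrS. Qed.

Lemma lenV_le (w : gT) : w \in <<S>>%g -> (len S w^-1 <= len S w)%N.
Proof.
case/len_exprP=> t [tS <- <-]; rewrite -(size_rev t).
have ->: ((\prod_(s <- t) s)^-1 = \prod_(s <- rev t) s)%g.
  elim: t tS => [|s t IH] /=; first by rewrite !big_nil invg1.
  case/andP=> sS tS; rewrite big_cons invMg IH // rev_cons.
  by rewrite -cats1 big_cat big_cons big_nil /= mulg1 invS.
by apply: len_prod_le; rewrite all_rev.
Qed.

Lemma lenV (w : gT) : w \in <<S>>%g -> len S w^-1%g = len S w.
Proof.
move=> wS; apply/eqP; rewrite eqn_leq lenV_le //=.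
by rewrite -{1}(invgK w) lenV_le ?groupV.
Qed.

Lemma lenMl_le (s w : gT) : s \in S -> w \in <<S>>%g ->
  (len S (s * w) <= (len S w).+1)%N.
Proof.
move=> sS /len_exprP[t [tS <- <-]].
have -> : (s * \prod_(x <- t) x = \prod_(x <- s :: t) x)%g by rewrite big_cons.
by apply: len_prod_le; rewrite /= sS.
Qed.

Variables (R : realType) (sgn : gT -> R).
Hypothesis sgnM : {morph sgn : x y / (x * y)%g >-> x * y}.
Hypothesis sgnS : {in S, forall s, sgn s = -1}.

(** The sign of an element is -1 to the power of its length, and multiplication by [s] changes the
    sign. *)
Lemma lenMl_neq (s w : gT) : s \in S -> w \in <<S>>%g ->
  len S (s * w)%g != len S w.
Proof.
move=> sS wS.
have sgn1 : sgn 1%g = 1.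
  apply: oppr_inj; have := sgnM 1%g s.
  by rewrite mul1g sgnS // mulrN1 => <-.
have sgnE x : x \in <<S>>%g -> sgn x = (-1) ^+ len S x.
  case/len_exprP=> t [tS <- <-].
  elim: t tS => [|y t IH] /=; first by rewrite big_nil.
  by case/andP=> yS tS; rewrite big_cons sgnM sgnS // IH // exprS.
apply/eqP => lE; have swS : (s * w)%g \in <<S>>%g by rewrite groupM // mem_gen.
have := sgnM s w; rewrite (sgnS sS) !sgnE //.
rewrite lE => /eqP; rewrite mulN1r -addr_eq0 -mulr2n mulrn_eq0 /=.
by rewrite signr_eq0.
Qed.

Lemma lenMl (s w : gT) : s \in S -> w \in <<S>>%g ->
  len S (s * w)%g = (len S w).+1 \/ len S w = (len S (s * w)%g).+1.
Proof.
move=> sS wS; have := lenMl_le sS wS; have := lenMl_neq sS wS.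
have swS : (s * w)%g \in <<S>>%g by rewrite groupM // mem_gen.
have := lenMl_le sS swS; rewrite mulgA sqrS // mul1g.
by lia.
Qed.

End LengthTheory.

(** * Laurent polynomials: the subring Z[v] and its ideal vZ[v] *)

Section LaurentTheory.
Implicit Types (a b : laurent) (p : {poly int}).

Lemma mulVv : vV * v = 1. Proof. by rewrite mulrC mulvV. Qed.

(** At [v] this is the inclusion of Z[v]; at [vV] it gives the bar conjugate of the same element,
    see [bar_eval_v]. *)
Definition eval_at a p : laurent := (map_poly intr p).[a].

Lemma eval_at0 a : eval_at a 0 = 0.
Proof. by rewrite /eval_at rmorph0 horner0. Qed.
Lemma eval_at1 a : eval_at a 1 = 1.
Proof. by rewrite /eval_at rmorph1 hornerC. Qed.
Lemma eval_atM a p q : eval_at a (p * q) = eval_at a p * eval_at a q.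
Proof. by rewrite /eval_at rmorphM hornerM. Qed.
Lemma eval_atD a p q : eval_at a (p + q) = eval_at a p + eval_at a q.
Proof. by rewrite /eval_at rmorphD hornerD. Qed.
Lemma eval_atB a p q : eval_at a (p - q) = eval_at a p - eval_at a q.
Proof. by rewrite /eval_at rmorphB hornerD hornerN. Qed.
Lemma eval_atC a (z : int) : eval_at a z%:P = z%:~R.
Proof. by rewrite /eval_at map_polyC hornerC. Qed.
Lemma eval_atX a : eval_at a 'X = a.
Proof. by rewrite /eval_at map_polyX hornerX. Qed.
Lemma eval_atXn a k : eval_at a 'X^k = a ^+ k.
Proof. by rewrite /eval_at map_polyXn hornerXn. Qed.
Lemma eval_at_sum a p :
  eval_at a p = \sum_(i < size p) (p`_i)%:~R * a ^+ i.
Proof.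
rewrite /eval_at (@horner_coef_wide _ (size p)) ?size_map_poly_leq //.
  by apply: eq_bigr => i _; rewrite coef_map.
by apply: size_poly.
Qed.

Lemma laurent_valD a b : laurent_val (a + b) = laurent_val a + laurent_val b.
Proof. by []. Qed.
Lemma laurent_valM a b : laurent_val (a * b) = laurent_val a * laurent_val b.
Proof. by []. Qed.
Lemma laurent_val0 : laurent_val 0 = 0. Proof. by []. Qed.
Lemma laurent_val1 : laurent_val 1 = 1. Proof. by []. Qed.
Lemma laurent_val_int (z : int) : laurent_val z%:~R = z%:~R.
Proof. exact: (rmorph_int (\val : laurent -> {fraction {poly int}})). Qed.

Lemma val_eval_v p : laurent_val (eval_at v p) = tofrac p.
Proof.
elim/poly_ind: p => [|p c IH].
  by rewrite eval_at0 laurent_val0 tofrac0.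
rewrite eval_atD eval_atM eval_atX eval_atC laurent_valD laurent_valM IH.
by rewrite laurent_val_int tofracD tofracM -[in RHS](intz c) !rmorph_int.
Qed.

Lemma eval_v_inj : injective (eval_at v).
Proof.
move=> p q /(congr1 laurent_val); rewrite !val_eval_v => /eqP.
by rewrite tofrac_eq => /eqP.
Qed.

Lemma vVBv_neq0 : vV - v != 0.
Proof.
apply/eqP => /(congr1 (fun a => v * a)); rewrite mulrBr mulvV mulr0.
rewrite -expr2 -eval_atXn -[1](eval_at1 v) -eval_atB -[RHS](eval_at0 v).
move/eval_v_inj/(congr1 (fun p => p`_0)).
by rewrite coefB coef1 coefXn coefC.
Qed.

(** After multiplication by [v] the factor becomes the nonzero polynomial v^2 + 1, which is
    cancelled in the fraction field. *)
Lemma vDvV_reg a : (v + vV) * a = 0 -> a = 0.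
Proof.
move=> /(congr1 (fun b => v * b)); rewrite mulr0 mulrA mulrDr mulvV => E.
have /eqP := congr1 laurent_val E; rewrite laurent_valM laurent_val0.
rewrite mulf_eq0 => /orP[]; last first.
  by move/eqP => a0; apply: val_inj.
have ->: v * v + 1 = eval_at v ('X^2 + 1).
  by rewrite eval_atD eval_atXn eval_at1.
rewrite val_eval_v tofrac_eq0 => /eqP /(congr1 (fun p => p`_0)).
by rewrite coefD coef1 coefXn coefC.
Qed.

(** One side has only positive powers of [v], the other only negative ones. Clearing denominators
    turns this into a comparison of degrees. *)
Lemma vZv_bar_eq0 p : v * eval_at v p = vV * eval_at vV p -> p = 0.
Proof.
move=> E; apply/eqP; apply/negPn/negP => p0.
(* [q] is v^m p(v^-1) written as a polynomial; multiplying the hypothesis by v^(m+1) gives X^(m+2) p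
   = q, whose left side is too large. *)
pose m := size p; pose q : {poly int} := \sum_(i < m) (p`_i)%:P * 'X^(m - i).
have qE : eval_at v q = v ^+ m * eval_at vV p.
  rewrite (eval_at_sum vV) mulr_sumr /q.
  have evs (F : 'I_m -> {poly int}) :
      eval_at v (\sum_i F i) = \sum_i eval_at v (F i).
    by rewrite /eval_at rmorph_sum horner_sum.
  rewrite evs; apply: eq_bigr => i _.
  rewrite eval_atM eval_atC eval_atXn mulrCA; congr (_ * _).
  rewrite -[X in v ^+ X * _](subnK (ltnW (ltn_ord i))) exprD -mulrA -exprMn.
  by rewrite mulvV expr1n mulr1.
have : 'X^(m.+2) * p = q.
  apply: eval_v_inj; rewrite eval_atM eval_atXn qE !exprSr -mulrA E.
  by rewrite -mulrA [v * _]mulrA mulvV mul1r.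
move/(congr1 (fun r : {poly int} => size r)).
have sq : (size q <= m.+1)%N.
  apply: leq_trans (size_sum _ _ _) _; apply/bigmax_leqP => i _.
  rewrite mul_polyC; apply: leq_trans (size_scale_leq _ _) _.
  by rewrite size_polyXn ltnS leq_subr.
rewrite mulrC size_mulXn // => sE; move: sq; rewrite -sE.
have : (0 < size p)%N by rewrite size_poly_gt0.
by lia.
Qed.

Definition in_Zv a := exists p, a = eval_at v p.

Lemma in_vZvP a : in_vZv a <-> exists2 b, in_Zv b & a = v * b.
Proof.
split=> [[p ->]|[_ [p ->] ->]]; last by exists p.
by exists (eval_at v p) => //; exists p.
Qed.

Lemma in_ZvD a b : in_Zv a -> in_Zv b -> in_Zv (a + b).
Proof. by move=> [p ->] [q ->]; exists (p + q); rewrite eval_atD. Qed.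
Lemma in_ZvM a b : in_Zv a -> in_Zv b -> in_Zv (a * b).
Proof. by move=> [p ->] [q ->]; exists (p * q); rewrite eval_atM. Qed.
Lemma in_Zv_int (z : int) : in_Zv z%:~R.
Proof. by exists z%:P; rewrite eval_atC. Qed.
Lemma in_Zv_v : in_Zv v.
Proof. by exists 'X; rewrite eval_atX. Qed.

Lemma in_vZv_Zv a : in_vZv a -> in_Zv a.
Proof. by move=> /in_vZvP[b bZ ->]; apply: in_ZvM => //; apply: in_Zv_v. Qed.
Lemma in_vZvD a b : in_vZv a -> in_vZv b -> in_vZv (a + b).
Proof.
move=> /in_vZvP[c cZ ->] /in_vZvP[d dZ ->]; apply/in_vZvP; exists (c + d).
  exact: in_ZvD.
by rewrite mulrDr.
Qed.
Lemma in_vZvM a b : in_Zv a -> in_vZv b -> in_vZv (a * b).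
Proof.
move=> aZ /in_vZvP[c cZ ->]; apply/in_vZvP; exists (a * c); first exact: in_ZvM.
by rewrite mulrCA.
Qed.
Lemma in_vZvN a : in_vZv a -> in_vZv (- a).
Proof.
move=> aZ; rewrite -mulN1r -[-1]/(intr (-1)).
exact: in_vZvM (in_Zv_int _) _.
Qed.
Lemma in_vZv0 : in_vZv 0.
Proof. by exists 0; rewrite rmorph0 horner0 mulr0. Qed.
Lemma in_vZv_vM a : in_Zv a -> in_vZv (v * a).
Proof. by move=> aZ; apply/in_vZvP; exists a. Qed.
Lemma in_vZv_sum (I : finType) (F : I -> laurent) :
  (forall i, in_vZv (F i)) -> in_vZv (\sum_i F i).
Proof.
by move=> FZ; elim/big_ind: _ => //; [exact: in_vZv0|exact: in_vZvD].
Qed.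

Lemma in_Zv_vVM a : in_vZv a -> in_Zv (vV * a).
Proof. by move=> /in_vZvP[b bZ ->]; rewrite mulrA mulVv mul1r. Qed.

(** The integer is the constant term; such integers become the structure constants in
    [KL_mull_up]. *)
Lemma in_Zv_const a : in_Zv a -> exists z : int, in_vZv (a - z%:~R).
Proof.
move=> [p ->]; elim/poly_ind: p => [|p c _].
  by exists 0; rewrite eval_atC subrr; apply: in_vZv0.
exists c; rewrite eval_atD eval_atM eval_atX eval_atC addrK mulrC.
by apply: in_vZv_vM; exists p.
Qed.

Lemma laurentP a : exists p k, a * v ^+ k = eval_at v p.
Proof.
have /asboolP[p [k aE]] := laurent_valP a; exists p, k; apply: val_inj.
rewrite /= val_eval_v.
have -> : laurent_val (v ^+ k) = (tofrac 'X) ^+ k.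
  by elim: k {aE} => [|k IH]; rewrite ?laurent_val1 // !exprS laurent_valM IH.
rewrite aE divfK //.
by rewrite expf_neq0 ?fracX_neq0.
Qed.

End LaurentTheory.

(** * Multiplication in the standard basis *)

Section KazhdanLusztig.
Variables (R : realType) (gT : finGroupType) (S : {set gT}).
Hypothesis hW : is_weyl_group R S.
Variables (H : algType laurent) (T : gT -> H).
Hypotheses (hH : is_hecke_algebra S T) (hT : is_standard_basis S T).
Variable bar : {rmorphism H -> H}.
Hypothesis hbar : is_bar_involution S T bar.
Variable C : gT -> H.
Hypothesis hC : is_KL_basis T bar C.
Variable tau : {scalar H}.
Hypothesis htau : is_trace T tau.
Variable D : gT -> H.
Hypothesis hD : is_dual_KL_basis tau C D.
Implicit Types (x y z w u s t : gT) (h g : H) (a b c : laurent).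

Local Notation q := (vV - v).
Local Notation len := (len S).
Local Notation sqrS := (weyl_sqr hW).

(* lia only identifies syntactically equal atoms, so products are kept over
   the canonical instance displayed here. *)
Let mulgA x y z : (x * (y * z) = x * y * z)%g := mulgA x y z.
Let invMg x y : ((x * y)^-1 = y^-1 * x^-1)%g := invMg x y.

Lemma tauZ a h : tau (a *: h) = a * tau h.
Proof. exact: linearZ_LR. Qed.

Lemma T1 : T 1%g = 1.
Proof.
have := @hT [::]; rewrite !big_nil; apply.
by split; rewrite // big_nil len1.
Qed.

Lemma mulT_up s w : s \in S -> w \in <<S>>%g -> len (s * w)%g = (len w).+1 ->
  T s * T w = T (s * w)%g.
Proof.
move=> sS /len_exprP[t [tS tw ts]] lE.
have := @hT (s :: t); rewrite !big_cons tw => ->.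
  by rewrite -hT ?tw //; split; rewrite ?tw ?ts.
by split; rewrite /= ?sS // big_cons tw lE ts.
Qed.

(** When [s * w] is shorter, write [T w] as [T s * T (s * w)] and use the quadratic relation.
    Membership in [<<S>>] is carried along until [gen_simple] makes it automatic. *)
Lemma mulT_gen s w : s \in S -> w \in <<S>>%g ->
  T s * T w = T (s * w)%g + (if (len (s * w) < len w)%N then q else 0) *: T w.
Proof.
move=> sS wS; have [sgn [sgnM sgnS]] := weyl_sign hW.
have [lE|lE] := lenMl sqrS sgnM sgnS sS wS.
  by rewrite mulT_up // lE ltnNge leqnSn /= scale0r addr0.
have swS : (s * w)%g \in <<S>>%g by rewrite groupM // mem_gen.
have Tw : T w = T s * T (s * w)%g.
  by rewrite mulT_up // mulgA sqrS ?mul1g.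
by rewrite lE leqnn {1}Tw mulrA (hecke_rel hH).1 // mulrDl mul1r -scalerAl -Tw.
Qed.

(** The elements whose left multiplication preserves the span form a subalgebra containing the
    generators; apply this to the unit. *)
Lemma T_span h : exists f : gT -> laurent, h = \sum_(w in <<S>>%g) f w *: T w.
Proof.
pose span h := exists f : gT -> laurent, h = \sum_(w in <<S>>%g) f w *: T w.
have spanD g1 g2 : span g1 -> span g2 -> span (g1 + g2).
  move=> [f1 ->] [f2 ->]; exists (fun w => f1 w + f2 w).
  by rewrite -big_split; apply: eq_bigr => w _; rewrite scalerDl.
have spanZ c g : span g -> span (c *: g).
  move=> [f ->]; exists (fun w => c * f w).
  by rewrite scaler_sumr; apply: eq_bigr => w _; rewrite scalerA.
have spanT w : w \in <<S>>%g -> span (T w).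
  move=> wS; exists (fun x => (x == w)%:R); rewrite (bigD1 w) //= eqxx scale1r.
  by rewrite big1 ?addr0 // => x /andP[_ /negPf->]; rewrite scale0r.
suff : forall g, span g -> span (h * g).
  by move/(_ 1); rewrite mulr1; apply; rewrite -T1; apply: spanT.
elim/(hecke_gen hH): h =>
  [g|c h1 h2 IH1 IH2 g gs|h1 h2 IH1 IH2 g gs|s sS g [f ->]].
- by rewrite mul1r.
- rewrite mulrDl -scalerAl.
  by apply/spanD; [apply/spanZ; exact: IH1|exact: IH2].
- by rewrite -mulrA; apply/IH1/IH2.
rewrite mulr_sumr; elim/big_rec: _ => [|w g' wS gs].
  by rewrite -(scale0r (T 1%g)); apply/spanZ/spanT.
rewrite -scalerAr mulT_gen // scalerDr scalerA; apply/spanD => //.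
have swS : (s * w)%g \in <<S>>%g by rewrite groupM // mem_gen.
by apply/spanD; apply/spanZ/spanT.
Qed.

(* By duality with D, the #|gT| elements C y are independent in the span of the
   T w, w in <<S>>. *)
Lemma gen_simple : <<S>>%g = [set: gT].
Proof.
have [f fE] := choice (fun y => T_span (C y^-1%g)).
pose A := \matrix_(i < #|gT|, j < #|<<S>>%g|)
  tau (D (enum_val i) * T (enum_val j)).
pose B := \matrix_(j < #|<<S>>%g|, i < #|gT|) f (enum_val i) (enum_val j).
have AB : A *m B = 1%:M.
  apply/matrixP => i k; rewrite !mxE -(inj_eq enum_val_inj) -hD fE.
  rewrite mulr_sumr raddf_sum [RHS](big_enum_val (A := mem <<S>>%g)).
  apply: eq_bigr => j _.
  by rewrite !mxE -scalerAr /= tauZ mulrC.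
apply/eqP; rewrite eqEcard finset.subsetT cardsT.
exact: mulmx1_min AB.
Qed.

Lemma in_genS x : x \in <<S>>%g. Proof. by rewrite gen_simple inE. Qed.
Hint Resolve in_genS : core.

Lemma length_mull s w : s \in S ->
  len (s * w)%g = (len w).+1 \/ len w = (len (s * w)%g).+1.
Proof.
have [sgn [sgnM sgnS]] := weyl_sign hW => sS.
exact: (lenMl sqrS sgnM sgnS sS (in_genS w)).
Qed.

Lemma lengthV w : len w^-1%g = len w. Proof. exact: lenV sqrS _ _. Qed.

Lemma length_mulr s w : s \in S ->
  len (w * s)%g = (len w).+1 \/ len w = (len (w * s)%g).+1.
Proof.
move=> sS; rewrite -(lengthV w) -(lengthV (w * s)) invMg (invS sqrS sS).
exact: length_mull.
Qed.

Lemma mulTl s w : s \in S ->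
  T s * T w = T (s * w)%g + (if (len (s * w) < len w)%N then q else 0) *: T w.
Proof. by move=> sS; apply: mulT_gen. Qed.

Lemma length_ind (P : gT -> Prop) : P 1%g ->
  (forall s w, s \in S -> len (s * w)%g = (len w).+1 -> P w -> P (s * w)%g) ->
  forall w, P w.
Proof.
move=> P1 PS w; have [t [tS tw]] := len_exprP (in_genS w).
elim: t w tS tw => [|s t IH] w /=; first by rewrite big_nil => _ <-.
case/andP=> sS tS; rewrite big_cons => <-.
move: (len_prod_le tS) (IH _ tS erefl).
set p := (\prod_(x <- t) x)%g => /= l2 {}IH lE.
have l1 := lenMl_le sS (in_genS p).
by apply: PS => //; [|apply: IH]; lia.
Qed.

Lemma mulTr s w : s \in S ->
  T w * T s = T (w * s)%g + (if (len (w * s) < len w)%N then q else 0) *: T w.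
Proof.
move=> sS.
have up x : len (x * s)%g = (len x).+1 -> T x * T s = T (x * s)%g.
  have [t [tS tx ts]] := len_exprP (in_genS x) => lE.
  have := @hT (rcons t s); rewrite -!cats1 !big_cat !big_seq1 /= tx => ->.
    by rewrite -hT ?tx //; split; rewrite ?tx ?ts.
  split; first by rewrite all_cat tS /= sS.
  by rewrite big_cat big_seq1 /= tx lE size_cat ts addn1.
have [lE|lE] := length_mulr w sS.
  by rewrite up // lE ltnNge leqnSn /= scale0r addr0.
have Tw : T w = T (w * s)%g * T s by rewrite up // -mulgA sqrS ?mulg1.
rewrite lE leqnn {1}Tw -mulrA (hecke_rel hH).1 // mulrDr mulr1 -scalerAr.
by rewrite -Tw.
Qed.

(** * The symmetrizing trace and standard coefficients *)

Lemma tau_TT x y : tau (T x * T y) = (x * y == 1)%g%:R.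
Proof.
elim/length_ind: y x => [|s y sS lE IH] x; first by rewrite T1 mulr1 htau mulg1.
have -> : T (s * y)%g = T s * T y.
  by rewrite mulTl // lE ltnNge leqnSn /= scale0r addr0.
rewrite mulrA mulTr // mulrDl linearD -scalerAl tauZ !IH /= mulgA.
(* The quadratic term can contribute only if x = y^-1, and then [x * s] is longer than [x], so its
   factor is 0. *)
have [xy|_] := eqVneq (x * y)%g 1%g; last by rewrite mulr0 addr0.
have -> : x = y^-1%g by rewrite -[LHS](mulgK y) xy mul1g.
have -> : (y^-1 * s = (s * y)^-1)%g by rewrite invMg (invS sqrS sS).
rewrite !lengthV lE ltnNge leqnSn /=.
by rewrite mul0r addr0.
Qed.

Lemma T_spanP h : exists f : gT -> laurent, h = \sum_w f w *: T w.
Proof.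
have [f ->] := T_span h; exists f; apply: eq_bigl => w; exact: in_genS.
Qed.

Lemma tau_mulC g h : tau (g * h) = tau (h * g).
Proof.
have [f ->] := T_spanP g; have [f' ->] := T_spanP h.
rewrite !mulr_suml !linear_sum; under eq_bigr do rewrite mulr_sumr linear_sum.
under [RHS]eq_bigr do rewrite mulr_sumr linear_sum.
rewrite /= exchange_big; apply: eq_bigr => x _; apply: eq_bigr => y _ /=.
rewrite -!(scalerAl, scalerAr) !tauZ !tau_TT mulrCA.
congr (_ * (_ * (nat_of_bool _)%:R)).
by rewrite -eq_invg_mul eq_sym -[y in RHS]invgK -eq_mulgV1.
Qed.

(** The coefficient of [T x] in [h], by [tau_TT]. Expressed through the trace it is visibly linear
    and needs no choice of expansion. *)
Definition cf x h := tau (h * T x^-1%g).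

Lemma cfT x y : cf x (T y) = (x == y)%:R.
Proof. by rewrite /cf tau_TT -eq_mulgV1 eq_sym. Qed.
Lemma cfD x h g : cf x (h + g) = cf x h + cf x g.
Proof. by rewrite /cf mulrDl linearD. Qed.
Lemma cfZ x a h : cf x (a *: h) = a * cf x h.
Proof. by rewrite /cf -scalerAl tauZ. Qed.
Lemma cf0 x : cf x 0 = 0.
Proof. by rewrite /cf mul0r linear0. Qed.
Lemma cfN x h : cf x (- h) = - cf x h.
Proof. by rewrite /cf mulNr linearN. Qed.
Lemma cfB x h g : cf x (h - g) = cf x h - cf x g.
Proof. by rewrite cfD cfN. Qed.
Lemma cf_sum (I : finType) x (F : I -> H) :
  cf x (\sum_i F i) = \sum_i cf x (F i).
Proof. by rewrite /cf mulr_suml linear_sum. Qed.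

Lemma cf_basis x (f : gT -> laurent) : cf x (\sum_w f w *: T w) = f x.
Proof.
rewrite cf_sum (bigD1 x) //= cfZ cfT eqxx mulr1 big1 ?addr0 // => w /negPf wx.
by rewrite cfZ cfT eq_sym wx mulr0.
Qed.

Lemma cf_expand h : h = \sum_w cf w h *: T w.
Proof.
have [f ->] := T_spanP h; apply: eq_bigr => w _; by rewrite cf_basis.
Qed.

Lemma cf_ext g h : (forall x, cf x g = cf x h) -> g = h.
Proof.
move=> E; rewrite (cf_expand g) (cf_expand h).
by apply: eq_bigr => x _; rewrite E.
Qed.

Lemma cf_mulTl s x h : s \in S ->
  cf x (T s * h) =
  cf (s * x)%g h + (if (len (s * x) < len x)%N then q else 0) * cf x h.
Proof.
move=> sS; rewrite /cf -mulrA tau_mulC -mulrA mulTr // mulrDr linearD.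
rewrite -scalerAr tauZ invMg (invS sqrS sS) lengthV -(lengthV (_ * s)%g).
by rewrite invMg invgK (invS sqrS sS).
Qed.

Lemma cf_mulTr s x h : s \in S ->
  cf x (h * T s) =
  cf (x * s)%g h + (if (len (x * s) < len x)%N then q else 0) * cf x h.
Proof.
move=> sS; rewrite /cf -mulrA mulTl // mulrDr linearD.
rewrite -scalerAr tauZ invMg (invS sqrS sS) lengthV -(lengthV (s * _)%g).
by rewrite invMg invgK (invS sqrS sS).
Qed.

(** * The exchange condition and minimal coset representatives *)

Lemma length_mul_le x y : (len (x * y)%g <= len x + len y)%N.
Proof.
elim/length_ind: x => [|s x sS lE IH]; first by rewrite mul1g len1.
by rewrite -mulgA; have [->|] := length_mull (x * y)%g sS; lia.
Qed.

(* Compare the coefficients of T (s * w) in (T s * T w) * T t and in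
   T s * (T w * T t). *)
Lemma folding s t w : s \in S -> t \in S ->
  len (s * w)%g = (len w).+1 -> len (w * t)%g = (len w).+1 ->
  len (s * w * t)%g = len w -> (s * w = w * t)%g.
Proof.
move=> sS tS swE wtE swtE; apply/eqP.
have : cf (s * w)%g ((T s * T w) * T t) = cf (s * w)%g (T s * (T w * T t)).
  by rewrite mulrA.
rewrite mulTl // swE ltnNge leqnSn /= scale0r addr0 mulTr // swtE swE leqnn.
rewrite [T w * _]mulTr // wtE ltnNge leqnSn /= scale0r addr0 mulTl // mulgA.
rewrite swtE wtE leqnn !cfD !cfZ !cfT => /addrI.
rewrite eqxx mulr1; case: eqP => // _ /eqP.
by rewrite mulr0 (negPf vVBv_neq0).
Qed.

(** The reflection [b * s * b^-1] shortens [a]. The induction strips the first letter [r] of [a]: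
    either the shortening already occurs without [r], or it is caused by [r] and [folding]
    applies. *)
Lemma exchange (a b s : gT) : s \in S -> len (a * b)%g = (len a + len b)%N ->
  len (b * s)%g = (len b).+1 -> (len (a * b * s)%g < len (a * b)%g)%N ->
  (len (a * (b * s * b^-1))%g < len a)%N.
Proof.
move=> sS; elim/length_ind: a => [|r a rS raE IH].
  by rewrite mul1g => _ ->; lia.
rewrite -!mulgA => rabE bsE; set x := (a * b)%g in rabE *.
have xE : len x = (len a + len b)%N.
  have := length_mul_le a b; rewrite -/x.
  by have [lE|lE] := length_mull x rS; move: lE rabE; rewrite raE; lia.
have xsE : (a * (b * s) = x * s)%g by rewrite mulgA.
rewrite xsE => rabs.
have [lE|lE] := length_mulr x sS; last first.
  have := IH xE bsE; rewrite -/x lE leqnn -!mulgA => /(_ isT) lt.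
  by have [->|] := length_mull (a * (b * (s * b^-1)))%g rS; lia.
have rxE : len (r * x)%g = (len x).+1 by rewrite rabE raE xE.
have fold : (r * x = x * s)%g.
  apply: folding => //; rewrite -mulgA.
  by have [|] := length_mull (x * s)%g rS; lia.
have -> : (r * (a * (b * (s * b^-1))) = a)%g.
  rewrite !mulgA -(mulgA r a) -/x fold -(mulgA x) sqrS // mulg1.
  by rewrite /x mulgK.
by rewrite raE.
Qed.

Lemma generated_ind (J : {set gT}) (P : gT -> Prop) : P 1%g ->
  (forall w s, w \in <<J>>%g -> s \in J -> P w -> P (w * s)%g) ->
  forall w, w \in <<J>>%g -> P w.
Proof.
move=> P1 PS w /gen_prodgP[k [c cJ ->]]; elim: k c cJ => [|k IH] c cJ.
  by rewrite big_ord0.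
rewrite big_ord_recr /=; apply: PS => //.
  by apply: group_prod => i _; apply/mem_gen.
by apply: IH.
Qed.

Definition min_coset (J : {set gT}) m :=
  [forall w in <<J>>%g, len m <= len (m * w)%g]%N.

Lemma min_cosetP (J : {set gT}) m :
  reflect (forall w, w \in <<J>>%g -> len m <= len (m * w)%g)%N (min_coset J m).
Proof. exact: 'forall_implyP. Qed.

Lemma exists_min_coset (J : {set gT}) x :
  exists2 w, w \in <<J>>%g & min_coset J (x * w)%g.
Proof.
case: (@arg_minnP _ 1%g (mem <<J>>%g) (fun w => len (x * w)%g)) => [|w wJ wm].
  exact: group1.
exists w => //; apply/min_cosetP => u uJ; rewrite -mulgA; apply: wm.
exact: groupM.
Qed.

(** If appending [s] lengthened [w] but shortened [m * w], then by [exchange] the element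
    [w * s * w^-1] of [<<J>>] would shorten [m]. If it shortens [w], subadditivity of length
    decides. *)
Lemma length_min_coset (J : {set gT}) m w : J \subset S -> min_coset J m ->
  w \in <<J>>%g -> len (m * w)%g = (len m + len w)%N.
Proof.
move=> /fintype.subsetP JS /min_cosetP mJ.
elim/generated_ind => [|{}w s wJ sJ IH].
  by rewrite mulg1 len1 addn0.
have sS := JS s sJ; have sgJ := mem_gen sJ; rewrite mulgA.
have [wsE|wsE] := length_mulr w sS; last first.
  have := length_mul_le m (w * s)%g; rewrite mulgA.
  by have [|] := length_mulr (m * w)%g sS; lia.
have [|mwsE] := length_mulr (m * w)%g sS; first by lia.
have /mJ : (w * s * w^-1)%g \in <<J>>%g by rewrite !groupM ?groupV.
by rewrite leqNgt exchange // mwsE.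
Qed.

(** * The bar involution and its uniqueness principle *)

Definition barL a : laurent := tau (bar a%:A).

Lemma tau_alg a : tau a%:A = a.
Proof. by rewrite tauZ -T1 htau eqxx mulr1. Qed.

Lemma algM a b : (a * b)%:A = a%:A * b%:A :> H.
Proof. by rewrite -scalerAl mul1r scalerA. Qed.

Lemma bar_eval_v p : bar (eval_at v p)%:A = (eval_at vV p)%:A.
Proof.
elim/poly_ind: p => [|p c IH]; first by rewrite !eval_at0 !scale0r rmorph0.
rewrite !eval_atD !eval_atM !eval_atX !eval_atC !scalerDl rmorphD.
rewrite !algM rmorphM IH; have [_ -> _] := hbar.
by rewrite !scaler_int rmorph_int.
Qed.

(** [bar] is only a ring morphism with a prescribed value at [v]. Every scalar has the form p(v)
    v^-k, and its image is the scalar p(v^-1) v^k. *)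
Lemma barLE a : bar a%:A = (barL a)%:A.
Proof.
suff [b bE] : exists b, bar a%:A = b%:A by rewrite /barL bE tau_alg.
have [p [k aE]] := laurentP a; exists (eval_at vV p * v ^+ k).
rewrite algM -bar_eval_v -aE algM rmorphM -(eval_atXn v k) bar_eval_v.
by rewrite !eval_atXn -mulrA -algM -exprMn mulVv expr1n scale1r mulr1.
Qed.

Lemma barZ a h : bar (a *: h) = barL a *: bar h.
Proof. by rewrite -mulr_algl rmorphM barLE mulr_algl. Qed.

Lemma barL0 : barL 0 = 0.
Proof. by rewrite /barL scale0r rmorph0 linear0. Qed.

Lemma barL_vZv_fix a : in_vZv a -> barL a = a -> a = 0.
Proof.
move=> /in_vZvP[_ [p ->] ->]; rewrite /barL algM rmorphM bar_eval_v.
have [_ -> _] := hbar; rewrite -algM tau_alg => /esym/vZv_bar_eq0 ->.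
by rewrite eval_at0 mulr0.
Qed.

Lemma bar_T_simple s : s \in S -> bar (T s) = T s - q%:A.
Proof.
move=> sS; have [_ _ /(_ _ sS)[bT _]] := hbar.
have inv : T s * (T s - q%:A) = 1.
  by rewrite mulrBr mulr_algr (hecke_rel hH).1 // addrK.
by rewrite -[LHS]mulr1 -[X in _ * X = _]inv mulrA bT mul1r.
Qed.

(** Unitriangularity of [bar] for length: with [bar (T s)] equal to [T s] minus a scalar, the terms
    carrying [q] involve coefficients that vanish by induction. *)
Lemma cf_bar_T w x : (len w <= len x)%N -> cf x (bar (T w)) = (x == w)%:R.
Proof.
elim/length_ind: w x => [|s w sS swE IH] x; first by rewrite T1 rmorph1 -T1 cfT.
rewrite swE => lx.
have -> : T (s * w)%g = T s * T w.
  by rewrite mulTl // swE ltnNge leqnSn /= scale0r addr0.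
rewrite rmorphM bar_T_simple // mulrBl mulr_algl cfB cf_mulTl // cfZ.
rewrite [cf x _]IH; last exact: ltnW.
have -> : (x == w) = false by apply/eqP => xw; rewrite xw ltnn in lx.
rewrite !mulr0 addr0 subr0 IH; last by have [|] := length_mull x sS; lia.
by rewrite -(inj_eq (mulgI s)) mulgA sqrS // mul1g.
Qed.

Lemma cf_bar_top h x : (forall y, (len x < len y)%N -> cf y h = 0) ->
  cf x (bar h) = barL (cf x h).
Proof.
move=> h0; rewrite {1}(cf_expand h) rmorph_sum cf_sum (bigD1 x) //=.
rewrite barZ cfZ cf_bar_T // eqxx mulr1 big1 ?addr0 // => y yx.
rewrite barZ cfZ; have [/h0 ->|lyx] := ltnP (len x) (len y).
  by rewrite barL0 mul0r.
by rewrite cf_bar_T // eq_sym (negPf yx) mulr0.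
Qed.

Lemma longest_in (P : pred gT) x : P x ->
  exists2 y, P y & forall z, (len y < len z)%N -> ~~ P z.
Proof.
move=> Px; have [y Py ymax] := arg_maxnP len Px.
by exists y => // z; rewrite ltnNge; apply: contra; apply: ymax.
Qed.

(** At a longest element of the support [bar] acts by [barL] alone, so the coefficient there is a
    bar-invariant member of vZ[v], hence 0. This is the tool for identifying Kazhdan-Lusztig
    elements. *)
Lemma bar_vZv_eq0 h : bar h = h -> (forall x, in_vZv (cf x h)) -> h = 0.
Proof.
move=> bh hZ; apply: cf_ext => x; rewrite cf0; apply/eqP/negPn/negP => hx.
have [y hy ymax] := @longest_in (fun x => cf x h != 0) x hx.
case/eqP: hy; apply: barL_vZv_fix => //; rewrite -cf_bar_top ?bh // => z.
by move/ymax/negPn/eqP.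
Qed.

(** * The Kazhdan-Lusztig basis and multiplication by a simple element *)

Lemma KL_bar w : bar (C w) = C w. Proof. by have [] := hC w. Qed.

Lemma KL_coef x w : in_vZv (cf x (C w) - (x == w)%:R).
Proof.
have [_ [c [cZ ->]]] := hC w.
by rewrite cfD cf_basis cfT addrC addKr.
Qed.

(** [is_KL_basis] does not state triangularity. At a longest violation the coefficient minus its
    expected integer value is bar-invariant and in vZ[v], so it vanishes. *)
Lemma KL_coef_ge w x : (len w <= len x)%N -> cf x (C w) = (x == w)%:R.
Proof.
move=> lwx; apply/eqP/negPn/negP => hx.
have [y /andP[ly hy] ymax] := @longest_in
  (fun x => (len w <= len x)%N && (cf x (C w) != (x == w)%:R)) x
  (introT andP (conj lwx hx)).
have top : barL (cf y (C w)) = cf y (C w).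
  rewrite -cf_bar_top ?KL_bar // => z lz; move: (ymax z lz).
  have lwz := leq_ltn_trans ly lz; rewrite (ltnW lwz) negbK => /eqP ->.
  by case: eqP => // zw; rewrite zw ltnn in lwz.
case/eqP: hy; apply/eqP; rewrite -subr_eq0; apply/eqP.
apply: barL_vZv_fix; first exact: KL_coef.
rewrite -[in RHS]top /barL scalerBl rmorphB linearB /=; congr (_ - _).
by rewrite scaler_nat rmorph_nat -scaler_nat tau_alg.
Qed.

Lemma KL_coef_neq x w : x != w -> in_vZv (cf x (C w)).
Proof. by move=> /negPf xw; have := KL_coef x w; rewrite xw subr0. Qed.

Lemma KL_coef_Zv x w : in_Zv (cf x (C w)).
Proof.
rewrite -[cf _ _](subrK (x == w)%:R); apply: in_ZvD.
  exact/in_vZv_Zv/KL_coef.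
exact: (in_Zv_int (x == w)).
Qed.

Lemma cf_alg x a : cf x a%:A = a * (x == 1%g)%:R.
Proof. by rewrite -T1 cfZ cfT. Qed.

Lemma bar_TDv s : s \in S -> bar (T s + v%:A) = T s + v%:A.
Proof.
move=> sS; have [_ barv _] := hbar.
by rewrite rmorphD barv bar_T_simple // scalerBl opprB addrA addrNK.
Qed.

Lemma KL_simple s : s \in S -> C s = T s + v%:A.
Proof.
move=> sS; apply/eqP; rewrite -subr_eq0; apply/eqP/bar_vZv_eq0 => [|x].
  by rewrite rmorphB KL_bar bar_TDv.
rewrite cfB cfD cfT opprD addrA cf_alg; apply: in_vZvD; first exact: KL_coef.
by apply/in_vZvN/in_vZv_vM; apply: (in_Zv_int (x == 1%g)).
Qed.

Lemma KL_sqr s : s \in S -> C s * C s = (v + vV) *: C s.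
Proof.
move=> sS; rewrite {1}KL_simple // mulrDl mulr_algl scalerDl addrC.
congr (_ + _); rewrite KL_simple // mulrDr mulr_algr (hecke_rel hH).1 //.
by rewrite scalerDr scalerA mulVv scale1r -addrA -scalerDl subrK addrC.
Qed.

Lemma cf_KL_mull s x h : s \in S -> cf x (C s * h) =
  cf (s * x)%g h + (if (len (s * x) < len x)%N then vV else v) * cf x h.
Proof.
move=> sS; rewrite KL_simple // mulrDl cfD cf_mulTl // mulr_algl cfZ -addrA.
by rewrite -mulrDl; congr (_ + _ * _); case: ifP => _; rewrite ?subrK ?add0r.
Qed.

(** Take [m x] to be the constant term at [x] of the difference [h]. Subtracting the corresponding
    combination of the [C x] leaves a bar-invariant element with coefficients in vZ[v], which is
    0. *)
Lemma KL_mull_up s w : s \in S -> len (s * w)%g = (len w).+1 ->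
  exists2 m : gT -> int,
    C s * C w = C (s * w)%g + \sum_x (m x)%:~R *: C x &
    forall x, m x != 0 -> (len (s * x) < len x <= len w)%N.
Proof.
move=> sS swE; pose h := C s * C w - C (s * w)%g.
have /choice[m mP] : forall x, exists z : int, in_vZv (cf x h - z%:~R) /\
    (z != 0 -> (len (s * x) < len x <= len w)%N).
  move=> x; rewrite /h cfB cf_KL_mull //.
  have [lxw|lwx] := leqP (len x) (len w); last first.
    exists 0; split => //; rewrite subr0 (KL_coef_ge (ltnW lwx)).
    have lsx : (len w <= len (s * x)%g)%N by have [|] := length_mull x sS; lia.
    rewrite (KL_coef_ge lsx) KL_coef_ge ?swE //.
    have -> : (x == w) = false by apply/eqP => xw; rewrite xw ltnn in lwx.
    rewrite -(inj_eq (mulgI s)) mulgA sqrS // mul1g mulr0 addr0 subrr.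
    exact: in_vZv0.
  have xsw : x != (s * w)%g by apply/eqP => xE; rewrite xE swE ltnn in lxw.
  (* Only when [s * x] is shorter does the factor [vV] occur; it costs one power of [v] and may
     leave a constant term. Otherwise every term is in vZ[v]. *)
  have [sx|sx] := ltnP (len (s * x)%g) (len x).
    have xw : x != w by apply/eqP => xw; rewrite xw swE ltnNge leqnSn in sx.
    suff /in_Zv_const[z zP] : in_Zv
        (cf (s * x)%g (C w) + vV * cf x (C w) - cf x (C (s * w)%g)) by exists z.
    apply: in_ZvD; last exact/in_vZv_Zv/in_vZvN/KL_coef_neq.
    by apply: in_ZvD; [apply: KL_coef_Zv | apply/in_Zv_vVM/KL_coef_neq].
  exists 0; split => //; rewrite subr0.
  apply: in_vZvD; last exact/in_vZvN/KL_coef_neq.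
  apply: in_vZvD; last exact/in_vZv_vM/KL_coef_Zv.
  apply: KL_coef_neq; apply: contra xsw => /eqP <-.
  by rewrite mulgA sqrS // mul1g.
exists m => [|x]; last by have [_] := mP x.
apply/eqP; rewrite addrC -subr_eq -/h; apply/eqP.
apply/eqP; rewrite -subr_eq0; apply/eqP/bar_vZv_eq0 => [|x].
  rewrite !rmorphB rmorphM rmorph_sum !KL_bar; congr (_ - _).
  by apply: eq_bigr => y _; rewrite !scaler_int rmorphMz KL_bar.
rewrite cfB cf_sum.
have -> : \sum_y cf x ((m y)%:~R *: C y) =
    (m x)%:~R + \sum_y (m y)%:~R * (cf x (C y) - (x == y)%:R).
  rewrite (bigD1 x) //= [in RHS](bigD1 x) //= eqxx cfZ addrA; congr (_ + _).
    by rewrite mulrBr mulr1 addrC subrK.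
  by apply: eq_bigr => y /negPf; rewrite eq_sym cfZ => ->; rewrite subr0.
rewrite opprD addrA; apply: in_vZvD; first by have [] := mP x.
apply/in_vZvN/in_vZv_sum => y; apply: in_vZvM (in_Zv_int _) _.
exact: KL_coef.
Qed.

(** Apply [C s] to the formula of [KL_mull_up] for [s * w]. [KL_sqr] handles the left side,
    induction the shorter terms [C x], and cancelling them leaves [C w]. *)
Lemma KL_mull_down s w : s \in S -> (len (s * w)%g < len w)%N ->
  C s * C w = (v + vV) *: C w.
Proof.
move=> sS; have [n] := ubnP (len w); elim: n w => // n IH w ltn sw.
have [wE|wE] := length_mull w sS; first by rewrite wE ltnNge leqnSn in sw.
have sswE : len (s * (s * w))%g = (len (s * w)%g).+1.
  by rewrite mulgA sqrS // mul1g.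
have [m] := KL_mull_up sS sswE; rewrite mulgA sqrS // mul1g => CE mP.
have : C s * (C s * C (s * w)%g) = (v + vV) *: (C s * C (s * w)%g).
  by rewrite mulrA KL_sqr // scalerAl.
rewrite CE mulrDr scalerDr mulr_sumr scaler_sumr.
have -> : \sum_x C s * ((m x)%:~R *: C x) =
    \sum_x (v + vV) *: ((m x)%:~R *: C x).
  apply: eq_bigr => x _; have [->|/mP/andP[sx lx]] := eqVneq (m x) 0.
    by rewrite scale0r mulr0 scaler0.
  rewrite -scalerAr IH // ?scalerA 1?mulrC //.
  by rewrite -ltnS -wE in lx; apply: leq_trans lx _.
by move/addIr.
Qed.

Lemma KL_mull_descent s w : s \in S -> exists2 f : gT -> laurent,
  C s * C w = \sum_x f x *: C x &
  forall x, (len x < len (s * x))%N -> f x = 0.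
Proof.
move=> sS; have delta y : C y = \sum_x (x == y)%:R *: C x.
  rewrite (bigD1 y) //= eqxx scale1r big1 ?addr0 // => x /negPf ->.
  by rewrite scale0r.
have [swE|wE] := length_mull w sS; last first.
  exists (fun x => (v + vV) * (x == w)%:R) => [|x sx].
    rewrite KL_mull_down ?wE // {1}(delta w) scaler_sumr.
    by apply: eq_bigr => x _; rewrite scalerA.
  by case: eqP sx => [->|_ _]; rewrite ?mulr0 // wE ltnNge leqnSn.
have [m -> mP] := KL_mull_up sS swE.
exists (fun x => (x == (s * w)%g)%:R + (m x)%:~R) => [|x sx].
  rewrite {1}(delta (s * w)%g) -big_split; apply: eq_bigr => x _.
  by rewrite scalerDl.
have -> : (x == s * w)%g = false.
  apply/eqP => xE; move: sx.
  by rewrite xE mulgA sqrS // mul1g swE ltnNge leqnSn.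
have [->|/mP/andP[]] := eqVneq (m x) 0; first by rewrite addr0.
by rewrite ltnNge (ltnW sx).
Qed.

(** * The anti-involution sending [T w] to [T w^-1] *)

Definition star h : H := \sum_w cf w^-1%g h *: T w.

Lemma cf_star x h : cf x (star h) = cf x^-1%g h.
Proof. exact: cf_basis. Qed.

Lemma star_T w : star (T w) = T w^-1%g.
Proof.
by apply: cf_ext => x; rewrite cf_star !cfT -(inj_eq invg_inj) invgK.
Qed.

Lemma star1 : star 1 = 1.
Proof. by rewrite -T1 star_T invg1. Qed.

Lemma starD g h : star (g + h) = star g + star h.
Proof. by apply: cf_ext => x; rewrite !(cfD, cf_star). Qed.

Lemma starZ a h : star (a *: h) = a *: star h.
Proof. by apply: cf_ext => x; rewrite !(cfZ, cf_star). Qed.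

Lemma starN h : star (- h) = - star h.
Proof. by rewrite -scaleN1r starZ scaleN1r. Qed.

Lemma star_sum (I : finType) (F : I -> H) :
  star (\sum_i F i) = \sum_i star (F i).
Proof.
apply: cf_ext => x; rewrite cf_star !cf_sum.
by under [RHS]eq_bigr do rewrite cf_star.
Qed.

(** Induction on the left factor along the generators; for [T s] the rules [cf_mulTl] and [cf_mulTr]
    are mirror images. *)
Lemma starM g h : star (g * h) = star h * star g.
Proof.
elim/(hecke_gen hH): g h => [h|c g1 g2 IH1 IH2 h|g1 g2 IH1 IH2 h|s sS h].
- by rewrite star1 mul1r mulr1.
- by rewrite mulrDl -scalerAl !(starD, starZ) IH1 IH2 mulrDr scalerAr.
- by rewrite -mulrA !IH1 IH2 mulrA.
apply: cf_ext => x; rewrite star_T (invS sqrS sS) cf_star.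
rewrite cf_mulTl // cf_mulTr // !cf_star invMg (invS sqrS sS).
rewrite -{1}(lengthV (s * _)) invMg invgK.
by rewrite (invS sqrS sS) lengthV.
Qed.

Lemma star_bar h : star (bar h) = bar (star h).
Proof.
elim/(hecke_gen hH): h => [|c g1 g2 IH1 IH2|g1 g2 IH1 IH2|s sS].
- by rewrite star1 !rmorph1 star1.
- by rewrite rmorphD barZ !(starD, starZ) IH1 IH2 rmorphD barZ.
- by rewrite rmorphM !starM IH1 IH2 rmorphM.
rewrite star_T (invS sqrS sS) bar_T_simple // starD starN starZ star_T star1.
by rewrite (invS sqrS sS).
Qed.

(** [star] commutes with [bar] and permutes the standard basis, so the difference falls under
    [bar_vZv_eq0]. *)
Lemma star_KL w : star (C w) = C w^-1%g.
Proof.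
apply/eqP; rewrite -subr_eq0; apply/eqP/bar_vZv_eq0 => [|x].
  by rewrite rmorphB -star_bar !KL_bar.
rewrite cfB cf_star.
have -> : cf x^-1%g (C w) - cf x (C w^-1%g) =
    cf x^-1%g (C w) - (x^-1 == w)%g%:R - (cf x (C w^-1%g) - (x == w^-1)%g%:R).
  rewrite -[(x == _)](inj_eq invg_inj) invgK; ring.
by apply: in_vZvD; [|apply: in_vZvN]; apply: KL_coef.
Qed.

(** * The dual Kazhdan-Lusztig basis *)

Lemma tau_D_KL x y : tau (D x * C y) = (x == y^-1)%g%:R.
Proof. by rewrite -hD invgK. Qed.

Lemma tau_KL_expand g w : tau (g * C w) =
  tau (g * T w) + \sum_(x | x != w) cf x (C w) * tau (g * T x).
Proof.
rewrite [in LHS](cf_expand (C w)) mulr_sumr linear_sum (bigD1 w) //=.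
rewrite KL_coef_ge // eqxx scale1r; congr (_ + _); apply: eq_bigr => x _.
by rewrite -scalerAr tauZ.
Qed.

(** By unitriangularity of [C], induction on length gives that all [tau (g * T x)] vanish, and these
    are the coefficients of [g]. *)
Lemma tau_KL_nondeg g : (forall w, tau (g * C w) = 0) -> g = 0.
Proof.
move=> gC; apply: cf_ext => x; rewrite cf0 /cf; move: x^-1%g => {}x.
have [n] := ubnP (len x); elim: n x => // n IH x lx.
have := tau_KL_expand g x; rewrite gC big1 ?addr0 // => y yx.
have [lxy|lyx] := leqP (len x) (len y).
  by rewrite KL_coef_ge // (negPf yx) mul0r.
by rewrite IH ?mulr0 //; apply: leq_trans lyx _.
Qed.

Lemma D_expand h : h = \sum_u tau (h * C u^-1%g) *: D u.
Proof.
apply/eqP; rewrite -subr_eq0; apply/eqP/tau_KL_nondeg => w.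
rewrite mulrBl linearB mulr_suml linear_sum (bigD1 w^-1%g) //= big1 => [|x xw].
  by rewrite -scalerAl tauZ tau_D_KL eqxx mulr1 invgK addr0 subrr.
by rewrite -scalerAl tauZ tau_D_KL (negPf xw) mulr0.
Qed.

Lemma KL_expand h : h = \sum_x tau (D x^-1%g * h) *: C x.
Proof.
apply/eqP; rewrite -subr_eq0; apply/eqP; set g := _ - _.
have Dg u : tau (D u * g) = 0.
  rewrite mulrBr linearB mulr_sumr linear_sum (bigD1 u^-1%g) //=.
  rewrite big1 => [|x xw].
    by rewrite -scalerAr tauZ tau_D_KL invgK eqxx mulr1 addr0 subrr.
  rewrite -scalerAr tauZ tau_D_KL -(inj_eq invg_inj) invgK eq_sym (negPf xw).
  by rewrite mulr0.
apply: cf_ext => x; rewrite cf0 /cf tau_mulC (D_expand (T _)) mulr_suml.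
by rewrite linear_sum big1 // => u _; rewrite /= -scalerAl tauZ Dg mulr0.
Qed.

(** Dualizing reverses triangularity: apart from [T x], only strictly longer elements occur in
    [D x]. *)
Lemma tau_D_T x y : (len y <= len x)%N -> tau (D x * T y) = (x == y^-1)%g%:R.
Proof.
have [n] := ubnP (len y); elim: n y => // n IH y lyn lyx.
rewrite -tau_D_KL tau_KL_expand big1 ?addr0 // => z zy.
have [lyz|lzy] := leqP (len y) (len z).
  by rewrite KL_coef_ge // (negPf zy) mul0r.
rewrite IH; [|by apply: leq_trans lzy _|by apply: leq_trans (ltnW lzy) _].
have -> : (x == z^-1)%g = false.
  by apply/eqP => xz; move: lyx; rewrite xz lengthV leqNgt lzy.
by rewrite mulr0.
Qed.

Lemma cf_D x y : (len y <= len x)%N -> cf y (D x) = (y == x)%:R.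
Proof. by move=> lyx; rewrite /cf tau_D_T ?lengthV // invgK eq_sym. Qed.

(** Cyclicity of the trace moves [C w^-1] to the far right, where [C u^-1 * C w^-1] is the [star] of
    [C w * C u]. This translates the left pre-order into coefficients of products with [D x]. *)
Lemma tau_KL_D_KL w x u (f : gT -> laurent) : C w * C u = \sum_z f z *: C z ->
  tau (C w^-1%g * D x * C u^-1%g) = f x.
Proof.
move=> fE; rewrite -mulrA tau_mulC -mulrA -!star_KL -starM fE star_sum.
rewrite mulr_sumr linear_sum (bigD1 x) //= big1 => [|z zx].
  by rewrite starZ star_KL -scalerAr tauZ tau_D_KL invgK eqxx mulr1 addr0.
by rewrite starZ star_KL -scalerAr tauZ tau_D_KL invgK eq_sym (negPf zx) mulr0.
Qed.

(** Pair with [C z]: by [KL_mull_descent] the product [C s * C z] has no component at [u^-1], the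
    only one [D u] detects. *)
Lemma D_mul_KL_simple u s : s \in S -> (len u < len (u * s)%g)%N ->
  D u * C s = 0.
Proof.
move=> sS us; apply: tau_KL_nondeg => z; rewrite -mulrA.
have [f -> f0] := KL_mull_descent z sS.
rewrite mulr_sumr linear_sum big1 // => x _; rewrite /= -scalerAr tauZ tau_D_KL.
have [ux|_] := eqVneq u x^-1%g; last by rewrite mulr0.
rewrite f0 ?mul0r // -(lengthV (s * x)) invMg (invS sqrS sS) -ux.
by rewrite -(lengthV x) -ux.
Qed.

Lemma cf_KL_mulr s x h : s \in S -> cf x (h * C s) =
  cf (x * s)%g h + (if (len (x * s) < len x)%N then vV else v) * cf x h.
Proof.
move=> sS; rewrite KL_simple // mulrDr cfD cf_mulTr // mulr_algr cfZ -addrA.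
by rewrite -mulrDl; congr (_ + _ * _); case: ifP => _; rewrite ?subrK ?add0r.
Qed.

(** * Length-additive products, invertibility and the longest element *)

Lemma mulT_length x y : len (x * y)%g = (len x + len y)%N ->
  T x * T y = T (x * y)%g.
Proof.
elim/length_ind: x => [|s x sS sxE IH]; first by rewrite T1 !mul1r mul1g.
rewrite -mulgA sxE => sxyE; have := length_mul_le x y.
have [lE|lE] := length_mull (x * y)%g sS; last by rewrite lE sxyE; lia.
move=> _; have xyE : len (x * y)%g = (len x + len y)%N.
  by move: lE; rewrite sxyE => -[].
have -> : T (s * x)%g = T s * T x.
  by rewrite mulTl // sxE ltnNge leqnSn /= scale0r addr0.
by rewrite -mulrA IH // mulTl // lE ltnNge leqnSn /= scale0r addr0.
Qed.

Lemma T_linv w : exists g, g * T w = 1.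
Proof.
elim/length_ind: w => [|s w sS swE [g gw]]; first by exists 1; rewrite T1 mulr1.
exists (g * (T s - q%:A)).
have -> : T (s * w)%g = T s * T w.
  by rewrite mulTl // swE ltnNge leqnSn /= scale0r addr0.
have inv : (T s - q%:A) * T s = 1.
  by rewrite mulrBl mulr_algl (hecke_rel hH).1 // addrK.
by rewrite mulrA -(mulrA g) inv mulr1.
Qed.

(* C s * C w0 = (v + vV) *: C w0 forces the coefficients of C w0 to be
   v^(len w0 - len x). *)
Lemma longest_unique w0 : (forall x, len x <= len w0)%N ->
  forall x, len x = len w0 -> x = w0.
Proof.
move=> w0max.
have cE x : cf x (C w0) = vV ^+ len x * cf 1%g (C w0).
  elim/length_ind: x => [|s x sS sxE IH]; first by rewrite len1 mul1r.
  have sw0 : (len (s * w0)%g < len w0)%N.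
    have := w0max (s * w0)%g.
    by have [->|->] := length_mull w0 sS; rewrite ?ltnn.
  have := congr1 (cf x) (KL_mull_down sS sw0).
  rewrite cf_KL_mull // cfZ sxE ltnNge leqnSn /= addrC mulrDl => /addrI ->.
  by rewrite IH mulrA -exprS.
move=> x lx; have := cE w0.
rewrite KL_coef_ge // eqxx -lx -cE KL_coef_ge ?lx //.
by case: eqP => // _ /eqP; rewrite oner_eq0.
Qed.

(** * The left ideal annihilated by a parabolic subgroup, and the dual element generating it *)

Section Parabolic.
Variable J : {set gT}.
Hypothesis JS : J \subset S.

Definition annihJ h := forall s, s \in J -> h * C s = 0.

Definition etaJ : H := \sum_(w in <<J>>%g) (- v) ^+ len w *: T w.

Let JS_in s : s \in J -> s \in S. Proof. exact: (fintype.subsetP JS). Qed.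

Lemma cf_etaJ x : cf x etaJ = if x \in <<J>>%g then (- v) ^+ len x else 0.
Proof.
rewrite /etaJ big_mkcond -[RHS](cf_basis x (fun x =>
  if x \in <<J>>%g then (- v) ^+ len x else 0)).
by congr cf; apply: eq_bigr => w _; case: ifP => //; rewrite scale0r.
Qed.

(** Pair [x] with [x * s]: their coefficients differ by a factor [- v], and the two terms of
    [cf_KL_mulr] cancel. *)
Lemma annihJ_etaJ : annihJ etaJ.
Proof.
move=> s sJ; have sS := JS_in sJ; apply: cf_ext => x.
rewrite cf0 cf_KL_mulr // !cf_etaJ.
have -> : (x * s \in <<J>>)%g = (x \in <<J>>)%g.
  by apply: groupMr; apply: mem_gen.
case: (x \in <<J>>%g) => /=; last by rewrite mulr0 addr0.
have [->|->] := length_mulr x sS.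
  by rewrite ltnNge leqnSn /= exprS mulNr addNr.
by rewrite leqnn exprS mulNr mulrN mulrA mulVv mul1r subrr.
Qed.

Lemma annihJ_mull g h : annihJ h -> annihJ (g * h).
Proof. by move=> hJ s sJ; rewrite -mulrA hJ ?mulr0. Qed.

(** The relation [h * C s = 0] makes the coefficient at [x * s] a multiple of that at [x], so
    vanishing spreads from a minimal representative to its whole coset. *)
Lemma annihJ_ext h : annihJ h ->
  (forall m, min_coset J m -> cf m h = 0) -> h = 0.
Proof.
move=> hJ h0; apply: cf_ext => x; rewrite cf0.
have [w wJ xw] := exists_min_coset J x.
rewrite -(mulgK w x).
have : w^-1%g \in <<J>>%g by rewrite groupV.
elim/generated_ind: (w^-1)%g / => [|u s _ sJ IH]; first by rewrite mulg1 h0.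
have := congr1 (cf (x * w * u)%g) (hJ s sJ).
by rewrite cf0 cf_KL_mulr ?JS_in // IH mulr0 addr0 mulgA.
Qed.

(** If two minimal representatives satisfy m' = m w with [w] in [<<J>>], additivity of length from
    both sides forces [w] to have length 0. *)
Lemma cf_T_etaJ m m' : min_coset J m -> min_coset J m' ->
  cf m' (T m * etaJ) = (m' == m)%:R.
Proof.
move=> mJ m'J; rewrite mulr_sumr.
have -> : \sum_(w in <<J>>%g) T m * ((- v) ^+ len w *: T w) =
    \sum_(w in <<J>>%g) (- v) ^+ len w *: T (m * w)%g.
  apply: eq_bigr => w wJ.
  by rewrite -scalerAr mulT_length // (length_min_coset JS mJ wJ).
rewrite (bigD1 1%g) ?group1 //= len1 scale1r mulg1 cfD cfT big_mkcond cf_sum.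
rewrite big1 ?addr0 // => w _; case: ifP => [/andP[wJ w1]|_]; last exact: cf0.
rewrite cfZ cfT; case: eqP => [m'E|_]; last by rewrite mulr0.
have lm' := length_min_coset JS mJ wJ.
have /(length_min_coset JS m'J) : w^-1%g \in <<J>>%g by rewrite groupV.
rewrite m'E mulgK lm' lengthV => lE.
by case/eqP: w1; apply: (len_eq0 (in_genS w)); lia.
Qed.

Lemma annihJ_expand h : annihJ h ->
  h = (\sum_(m | min_coset J m) cf m h *: T m) * etaJ.
Proof.
move=> hJ; apply/eqP; rewrite -subr_eq0; apply/eqP/annihJ_ext => [s sJ|m mJ].
  by rewrite mulrBl hJ // annihJ_mull ?subrr //; apply: annihJ_etaJ.
rewrite cfB mulr_suml big_mkcond cf_sum (bigD1 m) //= mJ big1 => [|m' m'm].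
  by rewrite -scalerAl cfZ cf_T_etaJ // eqxx mulr1 addr0 subrr.
case: ifP => [m'J|_]; last exact: cf0.
by rewrite -scalerAl cfZ cf_T_etaJ // eq_sym (negPf m'm) mulr0.
Qed.

Variables w0 w0' : gT.
Hypotheses (hw0 : is_longest S [set: gT] w0) (hw0' : is_longest S <<J>>%g w0').

(** Let [m0] be minimal in the coset of [w0]. Maximality of [w0] and [w0'] with additive lengths
    gives [m0 * w0' = w0], and likewise for the inverse of [w0']; so [w0'] is an involution and [m0]
    is [w0 * w0']. Any minimal [m] is compared through [m * w0']. *)
Lemma longest_min_coset : min_coset J (w0 * w0')%g /\
  forall m, min_coset J m -> (len m <= len (w0 * w0')%g)%N /\
    (len m = len (w0 * w0')%g -> m = (w0 * w0')%g).
Proof.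
have w0max x : (len x <= len w0)%N by apply: hw0.2; rewrite inE.
have [w0'J w0'max] := hw0'.
have [y yJ m0J] := exists_min_coset J w0; set m0 := (w0 * y)%g in m0J.
have add m w : min_coset J m -> w \in <<J>>%g ->
    len (m * w)%g = (len m + len w)%N by apply: length_min_coset.
have yVJ : y^-1%g \in <<J>>%g by rewrite groupV.
have w0E : len w0 = (len m0 + len y^-1%g)%N by rewrite -add // mulgK.
have lw0' : (len m0 + len w0' = len w0)%N.
  have := w0max (m0 * w0')%g; rewrite add //.
  by have := w0'max _ yVJ; lia.
have m0w0' : (m0 * w0' = w0)%g.
  by apply: (longest_unique w0max); rewrite add.
have w0'V : (w0'^-1 = w0')%g.
  apply: (mulgI m0); rewrite m0w0'; apply: (longest_unique w0max).
  by rewrite add ?groupV // lengthV.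
have m0E : (w0 * w0' = m0)%g by rewrite -m0w0' -{2}w0'V mulgK.
rewrite m0E; split=> // m mJ; have := w0max (m * w0')%g; rewrite add // => lm.
split; first by lia.
move=> mE; apply: (mulIg w0'); rewrite m0w0'; apply: (longest_unique w0max).
by rewrite add // mE.
Qed.

Lemma min_coset_lt m s : min_coset J m -> s \in J ->
  (len m < len (m * s)%g)%N.
Proof.
move=> /min_cosetP mJ sJ; have := mJ s (mem_gen sJ).
by have [->|->] := length_mulr m (JS_in sJ); rewrite ?ltnn ?ltnSn.
Qed.

Lemma D_longest : D (w0 * w0')%g = T (w0 * w0')%g * etaJ.
Proof.
have [x0J x0max] := longest_min_coset.
rewrite [LHS]annihJ_expand => [|s sJ]; last first.
  by apply: D_mul_KL_simple; [apply: JS_in | apply: min_coset_lt].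
(* No minimal representative is longer than [w0 * w0'], so [cf_D] evaluates every coefficient in the
   sum. *)
congr (_ * _); rewrite (bigD1 (w0 * w0')%g) //= cf_D // eqxx scale1r.
rewrite big1 ?addr0 // => m /andP[mJ /negPf mx].
by rewrite cf_D ?mx ?scale0r //; apply: (x0max _ mJ).1.
Qed.

Lemma annihJ_left_ideal h : annihJ h ->
  exists g, h = g * D (w0 * w0')%g.
Proof.
move=> /annihJ_expand hE; have [g gT1] := T_linv (w0 * w0')%g.
exists ((\sum_(m | min_coset J m) cf m h *: T m) * g).
by rewrite D_longest mulrA -(mulrA _ g) gT1 mulr1.
Qed.

(** Were [u * s] shorter, [C s] could be inserted before [C u^-1] at the cost of a factor [v + vV].
    It then meets [D (w0 * w0')] and gives 0, so the nonzero coefficient [f] would vanish by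
    [vDvV_reg]. *)
Lemma leqL_annihJ u : leqL C u (w0 * w0')%g -> annihJ (D u).
Proof.
have [x0J _] := longest_min_coset.
case=> w [f [fE /eqP fx]] s sJ; have sS := JS_in sJ.
apply: D_mul_KL_simple => //.
have [->|uE] := length_mulr u sS; first exact: ltnSn.
case: fx; apply: vDvV_reg; rewrite -(tau_KL_D_KL _ fE) -tauZ scalerAr.
have su : (len (s * u^-1)%g < len u^-1%g)%N.
  by rewrite -(lengthV (s * _)) invMg invgK (invS sqrS sS) lengthV uE.
rewrite -(KL_mull_down sS su) mulrA -(mulrA _ (D _)).
by rewrite D_mul_KL_simple ?min_coset_lt // mulr0 mul0r linear0.
Qed.

Lemma left_ideal_D_longest : left_ideal (D (w0 * w0')%g) = LN C D (w0 * w0')%g.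
Proof.
set x0 := (w0 * w0')%g; apply/seteqP; split => [_ [g _ <-]|_ [c [c0 ->]]].
  exists (fun u => tau (g * D x0 * C u^-1%g)); split; last exact: D_expand.
  (* Expand [g] in the basis [C]; the summand at [w] is a multiple of the coefficient of [C x0] in
     [C w^-1 * C u], and a nonzero one would witness [leqL C u x0]. *)
  move=> u ux; rewrite (KL_expand g) !mulr_suml linear_sum big1 // => w _.
  rewrite -!scalerAl [LHS]tauZ -[w]invgK.
  rewrite (tau_KL_D_KL _ (KL_expand _)) invgK.
  have [->|fx] := eqVneq (tau (D x0^-1%g * (C w^-1%g * C u))) 0.
    by rewrite mulr0.
  case: ux; exists w^-1%g, (fun z => tau (D z^-1%g * (C w^-1%g * C u))).
  by split; first exact: KL_expand.
have /choice[g gE] : forall u, exists g, c u *: D u = g * D x0.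
  move=> u; have [ux|nux] := pselect (leqL C u x0); last first.
    by exists 0; rewrite c0 // scale0r mul0r.
  have [g ->] := annihJ_left_ideal (leqL_annihJ ux).
  by exists (c u *: g); rewrite scalerAl.
exists (\sum_u g u) => //.
by rewrite mulr_suml; apply: eq_bigr => u _; rewrite gE.
Qed.

End Parabolic.
End KazhdanLusztig.

Theorem proposition19 (R : realType) (gT : finGroupType) (S : {set gT})
    (hW : is_weyl_group R S)
    (H : algType laurent) (T : gT -> H)
    (hH : is_hecke_algebra S T) (hT : is_standard_basis S T)
    (bar : {rmorphism H -> H}) (hbar : is_bar_involution S T bar)
    (C : gT -> H) (hC : is_KL_basis T bar C)
    (tau : {scalar H}) (htau : is_trace T tau)
    (D : gT -> H) (hD : is_dual_KL_basis tau C D)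
    (W' : {group gT}) (hW' : is_parabolic S W')
    (w0 : gT) (hw0 : is_longest S [set: gT] w0)
    (w0' : gT) (hw0' : is_longest S W' w0') :
  left_ideal (D (w0 * w0')%g) = LN C D (w0 * w0')%g.
Proof.
case: hW' hw0' => J JS ->.
exact: (left_ideal_D_longest hW hH hT hbar hC htau hD).
Qed.
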